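(* Let $W$ be a weighted small-step walk in the quadrant, with associated group $G_W$ and with groups $\Gamma_t$ acting on its kernel curves $\mathcal C_t$. Let $n$ be a positive integer. The group $G_W$ is of finite order $2n$ if and only if there are infinitely many values of $t$ for which $\Gamma_t$ is of order $2n$. Moreover, in that case all groups $\Gamma_t$ are finite and the order of each of them divides $2n$.
   Context: A weighted small-step walk $W$ in the quadrant is given by real weights $p_{ij}\ge 0$, $i,j\in\{-1,0,1\}$, with $\sum_{i,j=-1}^{1}p_{ij}=1$. Its inventory is $$\chi_W(x,y)=\sum_{i,j=-1}^1 p_{ij}x^iy^j = xA_1(y)+B_1(y)+\frac{C_1(y)}{x}=yA_2(x)+B_2(x)+\frac{C_2(x)}{y},$$ where $A_1,B_1,C_1$ are Laurent polynomials in $y$ and $A_2,B_2,C_2$ are Laurent polynomials in $x$. It is assumed that none of $A_1,C_1,A_2,C_2$ is identically zero, so that $$\varphi_1(x,y)=\left(\frac{C_1(y)}{xA_1(y)},\,y\right),\qquad \varphi_2(x,y)=\left(x,\,\frac{C_2(x)}{yA_2(x)}\right)$$ are birational involutions of the $(x,y)$-plane. The group of $W$ is $G_W=\langle\varphi_1,\varphi_2\rangle$, the group of birational transformations of the $(x,y)$-plane generated by them. For a parameter $t$ ($t\in\mathbb C$, $t\neq0$), the kernel curve $\mathcal C_t$ is the complex curve $$\mathcal C_t:\quad Q_t(x,y)=xy\left(\sum_{i,j=-1}^1 p_{ij}x^iy^j-\frac1t\right)=0.$$ The involutions $\varphi_1,\varphi_2$ preserve each $\mathcal C_t$ (they restrict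 to the horizontal and the vertical involution of the curve, exchanging the two points of $\mathcal C_t$ with the same $y$-coordinate, respectively with the same $x$-coordinate). $\Gamma_t$ denotes the group of transformations of $\mathcal C_t$ generated by the restrictions of $\varphi_1$ and $\varphi_2$ to $\mathcal C_t$. *)

(* Defs.v *)
From mathcomp Require Import all_boot all_order all_algebra.
From mathcomp Require Import polyXY fraction complex.
From mathcomp Require Import boolp classical_sets functions cardinality reals.

Set Implicit Arguments.
Unset Strict Implicit.
Unset Printing Implicit Defensive.

Import Order.TTheory GRing.Theory Num.Theory.

Local Open Scope classical_set_scope.
Local Open Scope complex_scope.
Local Open Scope ring_scope.

(* The elements of H have two-sided inverses in H, so that H consists of
   birational maps when [op] is the composition of rational maps of the plane,
   and of bijections when [op] is the composition of functions. *)
Definition is_group (T : Type) (op : T -> T -> T) (e : T) (H : set T) : Prop :=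
  [/\ H e,
      forall g h, H g -> H h -> H (op g h)
    & forall g, H g -> exists2 h, H h & op g h = e /\ op h g = e].

Definition generated_group (T : Type) (op : T -> T -> T) (e : T)
  (S : set T) : set T := smallest (is_group op e) S.

Definition has_order (T : Type) (G : set T) (m : nat) : Prop :=
  (G #= `I_m)%card.

(* The field C(x, y); the outer variable is x, the inner one is y, so that
   [p.[a, b]] is the value of a polynomial p at x = a, y = b. *)
Notation ratfun R := {fraction {poly {poly R[i]}}}.

Section RationalFunctions.
Variable R : realType.
Local Notation C := R[i].
Local Notation K := (ratfun R).

Definition ofpoly (p : {poly {poly C}}) : K := FracField.tofrac p.
Definition cst (c : C) : K := ofpoly c%:P%:P.
Definition varx : K := ofpoly 'X.
Definition vary : K := ofpoly 'Y.

Definition polysubst (p : {poly {poly C}}) (psi : K * K) : K :=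
  (map_poly (map_poly cst) p).[psi.1, psi.2].

(* f o psi.  It does not depend on the representative of the fraction f when
   psi is dominant, in particular when psi is birational. *)
Definition subst (f : K) (psi : K * K) : K :=
  polysubst \n_(repr f) psi / polysubst \d_(repr f) psi.

Definition ratcomp (phi psi : K * K) : K * K :=
  (subst phi.1 psi, subst phi.2 psi).
Definition ratid : K * K := (varx, vary).

(* f is regular at a, with value c; the fraction need not be given in lowest
   terms, so that removable singularities are removed. *)
Definition has_value (f : K) (a : C * C) (c : C) : Prop :=
  exists p q : {poly {poly C}},
    [/\ q.[a.1, a.2] != 0, f = ofpoly p / ofpoly q
      & c = p.[a.1, a.2] / q.[a.1, a.2]].

Definition maps_to (phi : K * K) (a b : C * C) : Prop :=
  has_value phi.1 a b.1 /\ has_value phi.2 a b.2.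

End RationalFunctions.

(* The weights are indexed by 'I_3 x 'I_3: the index i : 'I_3 stands for the
   step i - 1 in {-1, 0, 1}. *)
Definition step (i : 'I_3) : int := i%:Z - 1.

Section Weights.
Variables (R : realType) (p : 'I_3 -> 'I_3 -> R).

(* The coefficients of x^(i-1) and of y^(j-1) in the inventory. *)
Definition coefx (i : 'I_3) : ratfun R :=
  \sum_(j < 3) cst (p i j)%:C * vary R ^ step j.
Definition coefy (j : 'I_3) : ratfun R :=
  \sum_(i < 3) cst (p i j)%:C * varx R ^ step i.

Definition A1 : ratfun R := coefx ord_max.
Definition C1 : ratfun R := coefx ord0.
Definition A2 : ratfun R := coefy ord_max.
Definition C2 : ratfun R := coefy ord0.

End Weights.

Record walk (R : realType) := Walk {
  weight : 'I_3 -> 'I_3 -> R;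
  weight_ge0 : forall i j, 0 <= weight i j;
  weight_sum1 : \sum_(i < 3) \sum_(j < 3) weight i j = 1;
  A1_neq0 : A1 weight != 0;
  C1_neq0 : C1 weight != 0;
  A2_neq0 : A2 weight != 0;
  C2_neq0 : C2 weight != 0
}.

Section Walk.
Variables (R : realType) (W : walk R).
Local Notation C := R[i].
Local Notation K := (ratfun R).
Local Notation p := (weight W).
Local Notation x := (varx R).
Local Notation y := (vary R).

Definition inventory : K :=
  \sum_(i < 3) \sum_(j < 3) cst (p i j)%:C * x ^ step i * y ^ step j.

Definition phi1 : K * K := (C1 p / (x * A1 p), y).
Definition phi2 : K * K := (x, C2 p / (y * A2 p)).

Definition walk_group : set (K * K) :=
  generated_group (@ratcomp R) (ratid R) [set phi1; phi2].

(* Q_t, with the factor x y distributed over the Laurent polynomial. *)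
Definition kernel (t : C) : {poly {poly C}} :=
  \sum_(i < 3) \sum_(j < 3) (p i j)%:C%:P%:P * 'X ^+ i * 'Y ^+ j
  - (t^-1)%:P%:P * 'X * 'Y.

Lemma kernelE (t : C) : ofpoly (kernel t) = x * y * (inventory - cst t^-1).
Proof.
have x0 : x != 0 by rewrite /varx /ofpoly tofrac_eq0 polyX_eq0.
have y0 : y != 0 by rewrite /vary /ofpoly tofrac_eq0 polyC_eq0 polyX_eq0.
rewrite /ofpoly /kernel tofracB !tofracM mulrBr; congr (_ - _); last first.
  by rewrite -mulrA mulrC.
rewrite rmorph_sum mulr_sumr; apply: eq_bigr => i _.
rewrite rmorph_sum mulr_sumr; apply: eq_bigr => j _.
have stepE z (k : 'I_3) : z != 0 :> K -> z * z ^ step k = z ^+ k.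
  by move=> z0; rewrite -{1}[z]expr1z -expfzDr// /step addrC subrK.
rewrite /= !tofracM !tofracXn -(stepE _ i x0) -(stepE _ j y0).
by rewrite [RHS]mulrACA; congr (_ * _); rewrite mulrCA.
Qed.

Definition kernel_curve (t : C) : set (C * C) :=
  [set a | (kernel t).[a.1, a.2] = 0].

Definition stable (t : C) (S : set (C * C)) : Prop :=
  S `<=` kernel_curve t /\
  forall a, S a -> (exists2 b, S b & maps_to phi1 a b) /\
                   (exists2 b, S b & maps_to phi2 a b).

(* phi1 and phi2 are only rational maps: they act as genuine transformations
   on the largest set of points of the curve from which every composite of
   them is defined.  Unless the curve contains a horizontal or a vertical
   line, this is the whole curve up to a countable set of points. *)
Definition regular_locus (t : C) : set (C * C) :=
  [set a | exists2 S, stable t S & S a].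

Definition restricts (t : C) (phi : K * K)
    (f : regular_locus t -> regular_locus t) : Prop :=
  forall a, maps_to phi (\val a) (\val (f a)).

Definition curve_group (t : C) : set (regular_locus t -> regular_locus t) :=
  generated_group
    (fun f g : regular_locus t -> regular_locus t => f \o g) id
    [set f | restricts phi1 f \/ restricts phi2 f].

End Walk.

Arguments restricts {R} W t phi f.
Arguments curve_group {R} W t _.

(* Main.v *)
Require Import Defs.
From HB Require Import structures.
From mathcomp Require Import all_boot all_order all_algebra.
From mathcomp Require Import polyXY generic_quotient fraction complex ring.
From mathcomp Require Import boolp classical_sets functions cardinality reals ereal.
From mathcomp Require lebesgue_measure.

(** Both groups consist of the values of words in two letters, the involutions
    [phi1] and [phi2]: composites of rational maps on one side ([ratword]),
    composites of transformations of the regular locus of the curve on the other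
    ([curveword]). A group generated by two involutions that are both different
    from the identity has order [2 * m], where [m] is the order of the product
    theta of the two ([has_order_dihedral]); if one of them is the identity, the
    order is 1 or 2. A word that is the identity rational map acts trivially on
    every curve, so each [curve_group W t] is a quotient of [walk_group W] and its
    order divides [2 * n] when the latter has order [2 * n]; both involutions of
    the plane differ from the identity, hence the order of the walk group, when
    finite, is twice the order of theta.

    The equivalence rests on a converse for almost all [t]: a word that is not the
    identity rational map acts trivially on only finitely many curves
    ([finite_trivial_restrictions]). Indeed the points that it fixes lie on an
    algebraic curve [F = 0]. A general horizontal line [y = y0] carries finitely
    many zeros of [F], whereas it meets the kernel curves of distinct parameters in
    distinct points, because the inventory determines [t]. If the word fixed
    all regular points of infinitely many kernel curves, the line would carry too
    many zeros of [F], provided that it meets these curves in regular points. The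
    latter holds for all [y0] outside a countable set: unless the kernel curve
    contains a horizontal or a vertical line, which happens for finitely many [t]
    only, an irregular point is the image, under one of the countably many words, of
    one of the finitely many points of the curve at which an involution degenerates
    ([countable_irregular]).

    Hence, if the walk group has order [2 * n], only finitely many words have to
    stay nontrivial for a curve group to have the same order, which happens for all
    but finitely many [t]. Conversely, if infinitely many curve groups have order
    [2 * n], theta has on each of these curves an order at most [2 * n], so its power
    of exponent [(2 * n)`!] is the identity on infinitely many curves and thus in the
    plane. The walk group is then finite, almost all curve groups have its order, and
    this order must be [2 * n] ([order_iff_family]). *)

Set Implicit Arguments.
Unset Strict Implicit.
Unset Printing Implicit Defensive.

Import Order.TTheory GRing.Theory Num.Theory.

Local Open Scope classical_set_scope.
Local Open Scope complex_scope.
Local Open Scope ring_scope.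

(** * Finite and countable sets *)

Lemma uncountable_complex (R : realType) (A : set R[i]) :
  countable A -> exists z, ~ A z.
Proof.
move=> cA; apply: contrapT => allA.
have cI : countable (`[0, 1]%classic : set R).
  apply: (@sub_countable _ _ _ A) => //.
  rewrite -(card_le_eql (inj_card_eq (f := real_complex R) _)); last first.
    by move=> r s _ _ [].
  by apply: subset_card_le => z _; apply: contrapT => Az; apply: allA; exists z.
(* The unit interval has measure 1, a countable set has measure 0. *)
have := lebesgue_measure.countable_lebesgue_measure0 cI.
rewrite lebesgue_measure.lebesgue_measure_itv /= lte01.
by rewrite oppr0 adde0 => -[] /eqP; rewrite oner_eq0.
Qed.

Lemma infinite_set_seq (T : choiceType) (A : set T) n : infinite_set A ->
  exists s : seq T, [/\ uniq s, (n <= size s)%N & forall x, x \in s -> A x].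
Proof.
move=> /(@infinite_set_fset _ _ n)[B BA nB]; exists (finmap.enum_fset B).
by split=> //; exact: finmap.fset_uniq.
Qed.

Lemma finite_roots (F : idomainType) (p : {poly F}) :
  p != 0 -> finite_set [set x | root p x].
Proof.
move=> p0; apply: contrapT => /(@infinite_set_seq _ _ (size p))[s [us ps sp]].
by move: ps; rewrite leqNgt max_poly_roots //; apply/allP.
Qed.

Lemma countableU (T : Type) (A B : set T) :
  countable A -> countable B -> countable (A `|` B).
Proof.
move=> cA cB; have -> : A `|` B = \bigcup_(b in [set: bool]) (if b then A else B).
  apply/seteqP; split=> x; first by move=> [Ax|Bx]; [exists true | exists false].
  by move=> [[] _ h]; [left | right].
by apply: bigcup_countable => [|[] _]; first exact: countableP.
Qed.

Lemma countable_image (T U : Type) (f : T -> U) (A : set T) :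
  countable A -> countable (f @` A).
Proof. exact/sub_countable/card_image_le. Qed.

(** * Polynomials in two variables *)

Lemma horner2_eval (R : realType) (F : {poly {poly R[i]}}) (x y : R[i]) :
  F.[x, y] = (map_poly (horner_eval y) F).[x].
Proof. by rewrite -horner_swapXY horner2_swapXY. Qed.

Lemma lead_coef_eval (R : realType) (F : {poly {poly R[i]}}) (y : R[i]) :
  ~~ root (lead_coef F) y -> map_poly (horner_eval y) F != 0.
Proof.
apply: contraNneq => /(congr1 (fun p : {poly R[i]} => p`_(size F).-1)).
by rewrite coef0 coef_map => /eqP.
Qed.

Lemma exists_nonroot (R : realType) (p : {poly R[i]}) : p != 0 -> exists x, ~~ root p x.
Proof.
move=> p0; have [x px] := uncountable_complex (finite_set_countable (finite_roots p0)).
by exists x; apply/negP.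
Qed.

Lemma exists_nonroot2 (R : realType) (F : {poly {poly R[i]}}) :
  F != 0 -> exists x y, F.[x, y] != 0.
Proof.
move=> F0; have [y Fy] : exists y, ~~ root (lead_coef F) y.
  by apply: exists_nonroot; rewrite lead_coef_eq0.
have [x Fx] := exists_nonroot (lead_coef_eval Fy).
by exists x, y; rewrite horner2_eval.
Qed.

(** * Groups generated by two involutions *)

Fixpoint alternating (b : bool) (k : nat) : seq bool :=
  if k is k'.+1 then b :: alternating (~~ b) k' else [::].

Lemma alternatingS b k :
  alternating b k.+1 = rcons (alternating b k) (b (+) odd k).
Proof.
elim: k b => [|k IH] b; first by rewrite /= addbF.
by rewrite -[LHS]/(b :: alternating (~~ b) k.+1) IH /= addNb addbN.
Qed.

Lemma alternating_cat b j l :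
  alternating b (j + l) = alternating b j ++ alternating (b (+) odd j) l.
Proof.
elim: j b => [|j IH] b; first by rewrite addbF.
by rewrite addSn /= IH addbN addNb.
Qed.

Lemma rev_alternating b k :
  rev (alternating b k) = alternating (b (+) ~~ odd k) k.
Proof.
elim: k b => [//|k IH] b.
by rewrite alternatingS rev_rcons IH /= negbK addbN.
Qed.

(** [ev] evaluates words in two involutory letters in a group; the values of [ev]
    are not assumed to lie in a structure in which [op] is associative, since the
    composition of arbitrary pairs of fractions is not. *)
Section DihedralWords.
Variables (T : Type) (op : T -> T -> T) (ev : seq bool -> T).
Hypothesis ev_cat : forall u v, ev (u ++ v) = op (ev u) (ev v).
Hypothesis ev_sqr : forall b, ev [:: b; b] = ev [::].

Lemma ev_delete w1 w2 u : ev u = ev [::] -> ev (w1 ++ u ++ w2) = ev (w1 ++ w2).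
Proof. by move=> h; rewrite ev_cat (ev_cat u) h -!ev_cat. Qed.

Lemma ev_cat_rev u : ev (u ++ rev u) = ev [::].
Proof.
elim/last_ind: u => [//|u b IH].
by rewrite rev_rcons -cats1 -catA (ev_delete _ _ (ev_sqr b)).
Qed.

Lemma ev_rev_cat u : ev (rev u ++ u) = ev [::].
Proof. by rewrite -{2}[u]revK ev_cat_rev. Qed.

Lemma ev_cancel u v : ev (u ++ v) = ev u -> ev v = ev [::].
Proof.
move=> h; rewrite -(ev_rev_cat u) [RHS]ev_cat -h -ev_cat catA.
by rewrite (ev_delete [::] v (ev_rev_cat u)).
Qed.

Lemma ev_rev_id u : ev u = ev [::] -> ev (rev u) = ev [::].
Proof. by move=> h; rewrite -(ev_cat_rev u) (ev_delete [::] (rev u) h). Qed.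

Lemma generated_group_words :
  generated_group op (ev [::]) [set ev [:: true]; ev [:: false]] = range ev.
Proof.
apply/seteqP; split=> [g gH|_ [u _ <-] H [[H1 Hop _] Hs]].
  apply: gH; split; last by move=> _ [] ->; [exists [:: true] | exists [:: false]].
  split; first by exists [::].
    by move=> _ _ [u _ <-] [v _ <-]; exists (u ++ v).
  move=> _ [u _ <-]; exists (ev (rev u)); first by exists (rev u).
  by rewrite -!ev_cat ev_cat_rev ev_rev_cat.
elim: u => [//|b u IH]; rewrite -cat1s ev_cat; apply: Hop => //.
by apply: Hs; case: b; [left | right].
Qed.

(** An alternating word of odd length is a palindrome, hence a conjugate of its
    middle letter. *)
Lemma odd_alternating_id b k : odd k -> ev (alternating b k) = ev [::] ->
  exists c, ev [:: c] = ev [::].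
Proof.
elim/ltn_ind: k b => -[//|[|k]] IH b ok; first by exists b.
have ok' : odd k by rewrite -[odd k]negbK.
rewrite alternatingS -cats1 /= ok' addbF => h.
apply: (IH k _ (~~ b)) => //.
move: (alternating _ k) h => w h.
rewrite -(ev_sqr b) -[RHS](ev_delete [:: b] [:: b] h) /= -catA /=.
by rewrite (ev_delete [::] _ (ev_sqr b)) -[in RHS](cats0 [:: b; b])
  (ev_delete w _ (ev_sqr b)) cats0.
Qed.

Section FinitePeriod.
Variable m : nat.
Hypothesis m_gt0 : (0 < m)%N.
Hypothesis period : ev (alternating true m.*2) = ev [::].

(** Appending a letter to an alternating word lengthens or shortens it by one; the
    period closes the lengths into a cycle of [m.*2] elements, so that no
    alternating words with first letter [false] are needed. *)
Lemma ev_alternating u : exists2 k, (k < m.*2)%N & ev u = ev (alternating true k).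
Proof.
elim/last_ind: u => [|u b [k km uk]]; first by exists 0%N; rewrite ?double_gt0.
rewrite -cats1 ev_cat uk -ev_cat.
case: (eqVneq b (~~ odd k)) => [->|bk].
  rewrite cats1 -(alternatingS true).
  move: (km); rewrite leq_eqVlt => /predU1P[->|]; last by exists k.+1.
  by exists 0%N; rewrite ?double_gt0.
case: k km uk bk => [|k] km _ bk.
  (* the letter [false] is the alternating word of length [m.*2 - 1] *)
  have m1 : (m.*2.-1).+1 = m.*2 by rewrite prednK ?double_gt0.
  exists m.*2.-1; first by rewrite m1.
  rewrite -[LHS](ev_delete [::] _ period) cat0s -m1 alternatingS.
  rewrite -cats1 -catA (_ : [:: _] ++ _ = [:: b; b]) ?ev_cat ?ev_sqr -?ev_cat ?cats0 //.
  by case: b bk; rewrite //= -[odd _]negbK -[~~ odd _]/(odd _.+1) m1 odd_double.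
exists k; first by rewrite ltnW.
rewrite alternatingS -cats1 -catA (_ : [:: _] ++ _ = [:: b; b]).
  by rewrite -[in LHS](cats0 [:: b; b]) (ev_delete _ _ (ev_sqr b)) cats0.
by move: bk => /=; case: (odd k) b => -[].
Qed.

Lemma range_ev_alternating :
  range ev = (fun k => ev (alternating true k)) @` `I_(m.*2).
Proof.
apply/seteqP; split=> [_ [u _ <-]|_ [k _ <-]]; last by eexists.
by have [k km ->] := ev_alternating u; exists k.
Qed.

Hypothesis letters_neq_id : forall b, ev [:: b] <> ev [::].
Hypothesis m_min :
  forall i, (0 < i < m)%N -> ev (alternating true i.*2) <> ev [::].

(** A coincidence of two alternating words cancels to the triviality of a shorter
    one: of odd length it would make a letter trivial, of even length it would be
    a smaller period. *)
Lemma alternating_inj j k : (j < k)%N -> (k < m.*2)%N ->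
  ev (alternating true k) <> ev (alternating true j).
Proof.
move=> jk km; rewrite -(subnKC (ltnW jk)) alternating_cat => /ev_cancel.
have l0 : (0 < k - j)%N by rewrite subn_gt0.
have lm : (k - j < m.*2)%N by rewrite (leq_ltn_trans _ km) ?leq_subr.
move: (k - j)%N (true (+) _) l0 lm => l b l0 lm lid.
have ol : ~~ odd l.
  by apply/negP => /odd_alternating_id/(_ lid)[c /letters_neq_id].
have {lid} lid : ev (alternating true l) = ev [::].
  case: b lid => // /ev_rev_id.
  by rewrite rev_alternating ol.
have lE : l = l./2.*2 by rewrite -[LHS]odd_double_half (negbTE ol).
rewrite lE in l0 lm lid; apply: (m_min _ lid).
by rewrite -double_gt0 l0 -ltn_double.
Qed.

Lemma has_order_dihedral : has_order (range ev) (2 * m).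
Proof.
rewrite /has_order range_ev_alternating mul2n.
apply: (@inj_card_eq _ _ `I_(m.*2)) => j k.
move=> /set_mem jm /set_mem km jk.
case: (ltngtP j k) => // [lt|lt]; first by case: (alternating_inj lt km).
by case: (alternating_inj lt jm).
Qed.

End FinitePeriod.

(** The group is generated by the other letter. *)
Lemma has_order_letter_id b : ev [:: b] = ev [::] ->
  exists2 k, (0 < k <= 2)%N & has_order (range ev) k.
Proof.
move=> b1; have r u : ev u = ev [::] \/ ev u = ev [:: ~~ b].
  elim: u => [|c u IH]; first by left.
  rewrite -cat1s; case: (eqVneq c b) => [->|cb].
    by rewrite (ev_delete [::] u b1).
  have -> : c = ~~ b by case: c b cb {b1 IH} => -[].
  rewrite ev_cat; case: IH => ->; rewrite -ev_cat; first by right.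
  by left; rewrite ev_sqr.
have [e|e] := pselect (ev [:: ~~ b] = ev [::]).
  exists 1%N => //; have -> : range ev = [set ev [::]].
    apply/seteqP; split=> [_ [u _ <-]|_ ->]; last by exists [::].
    by case: (r u) => -> //=; rewrite e.
  exact: card_set1.
exists 2 => //; pose f k := if k is 0%N then ev [::] else ev [:: ~~ b].
have -> : range ev = f @` `I_2.
  apply/seteqP; split=> [_ [u _ <-]|_ [k _ <-]].
    by case: (r u) => ->; [exists 0%N | exists 1%N].
  by case: k => [|k]; [exists [::] | exists [:: ~~ b]].
apply: (@inj_card_eq _ _ `I_2) => -[|[|j]] [|[|k]] /set_mem // _ /set_mem // _ h.
by case: e.
Qed.

(** Otherwise the powers of theta of exponent [0] to [k] are [k.+1] elements. *)
Lemma exists_period k : has_order (range ev) k ->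
  exists2 j, (0 < j <= k)%N & ev (alternating true j.*2) = ev [::].
Proof.
move=> ordk; apply: contrapT => noper.
suff: (k.+1 <= k)%N by rewrite ltnn.
have nocoinc i j : (i < j <= k)%N ->
    ev (alternating true j.*2) <> ev (alternating true i.*2).
  move=> /andP[ij jk]; rewrite -(subnKC (ltnW ij)) doubleD alternating_cat.
  move=> /ev_cancel; rewrite odd_double => h; apply: noper; exists (j - i)%N => //.
  by rewrite subn_gt0 ij (leq_trans (leq_subr _ _)).
pose f i := ev (alternating true i.*2).
have finj : {in `I_(k.+1) &, injective f}.
  move=> i j /set_mem ik /set_mem jk ij.
  case: (ltngtP i j) => // [lt|lt]; first by case: (@nocoinc i j); rewrite ?lt.
  by case: (@nocoinc j i); rewrite ?lt.
rewrite -card_le_II; apply: (card_le_trans (B := range ev)).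
  rewrite -(card_le_eql (inj_card_eq finj)); apply: subset_card_le.
  by move=> _ [i _ <-]; eexists.
by move: ordk; rewrite /has_order card_eq_le => /andP[].
Qed.

End DihedralWords.

Section Period.
Variables (T : Type) (op : T -> T -> T) (ev : seq bool -> T).
Hypothesis ev_cat : forall u v, ev (u ++ v) = op (ev u) (ev v).
Hypothesis ev_sqr : forall b, ev [:: b; b] = ev [::].

Local Notation theta i := (ev (alternating true i.*2)).

Lemma theta_period m q r : theta m = ev [::] -> theta (q * m + r) = theta r.
Proof.
move=> m1; elim: q => // q IH; rewrite mulSn -addnA doubleD alternating_cat.
by rewrite (ev_delete ev_cat [::] _ m1) odd_double.
Qed.

Lemma theta_dvd m N : theta m = ev [::] -> (m %| N)%N -> theta N = ev [::].
Proof. by move=> m1 /dvdnP[q ->]; rewrite -[(q * m)%N]addn0 theta_period. Qed.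

Lemma least_period N : (0 < N)%N -> theta N = ev [::] ->
  exists m, [/\ (0 < m)%N, (m %| N)%N, theta m = ev [::]
    & forall i, (0 < i < m)%N -> theta i <> ev [::]].
Proof.
move=> N0 N1.
have ex : exists m, (0 < m)%N && `[< theta m = ev [::] >].
  by exists N; rewrite N0; apply/asboolP.
case: (ex_minnP ex) => m /andP[m0 /asboolP m1] mmin.
have least i : (0 < i < m)%N -> theta i <> ev [::].
  move=> /andP[i0 im] i1; have := mmin i; rewrite i0 leqNgt im /=.
  by move/(_ (asboolT i1)).
exists m; split=> //; apply/negPn/negP; rewrite /dvdn -lt0n => r0.
apply: (least (N %% m)%N); first by rewrite r0 ltn_pmod.
by rewrite -(theta_period (N %/ m)%N _ m1) -divn_eq.
Qed.

(** The order of theta divides [N]; when a letter is the identity, the order of the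
    group is not twice that of theta, but it is 1 or 2. *)
Lemma has_order_dvd N : (0 < N)%N -> theta N = ev [::] ->
  exists2 k, has_order (range ev) k & (k %| 2 * N)%N.
Proof.
move=> N0 N1.
have [[b b1]|nletter] := pselect (exists b, ev [:: b] = ev [::]).
  have [k /andP[k0 k2] ordk] := has_order_letter_id ev_cat ev_sqr b1.
  exists k => //; rewrite dvdn_mulr //.
  by case: k k0 k2 {ordk} => [|[|[]]].
have [m [m0 mN m1 mmin]] := least_period N0 N1.
exists (2 * m)%N; last by rewrite dvdn_pmul2l.
apply: (has_order_dihedral ev_cat ev_sqr m0 m1) => // b b1.
by apply: nletter; exists b.
Qed.

End Period.

Lemma has_order_unique (T : Type) (G : set T) j k :
  has_order G j -> has_order G k -> j = k.
Proof.
by rewrite /has_order card_eq_sym => Gj Gk; apply/card_eq_II/(card_eq_trans Gj Gk).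
Qed.

(** A generic group [range ev] and a family of quotients [range (ev_ t)] of it, such
    that each nontrivial element survives in almost all of them. *)
Section DihedralFamily.
Variables (I T : Type) (op : T -> T -> T) (ev : seq bool -> T).
Hypothesis ev_cat : forall u v, ev (u ++ v) = op (ev u) (ev v).
Hypothesis ev_sqr : forall b, ev [:: b; b] = ev [::].
Hypothesis letters_neq_id : forall b, ev [:: b] <> ev [::].
Variables (T_ : I -> Type) (op_ : forall t, T_ t -> T_ t -> T_ t).
Variables (ev_ : forall t, seq bool -> T_ t) (J : set I).
Hypothesis J_infinite : infinite_set J.
Hypothesis ev_cat_ : forall t u v, ev_ t (u ++ v) = op_ (ev_ t u) (ev_ t v).
Hypothesis ev_sqr_ : forall t b, ev_ t [:: b; b] = ev_ t [::].
Hypothesis specialize : forall t u, ev u = ev [::] -> ev_ t u = ev_ t [::].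
Hypothesis finitely_many_exceptions : forall u, ev u <> ev [::] ->
  finite_set [set t | J t /\ ev_ t u = ev_ t [::]].

Local Notation G := (range ev).
Local Notation G_ t := (range (ev_ t)).
Local Notation theta i := (alternating true i.*2).

Lemma order_period k : has_order G k ->
  exists m, [/\ k = (2 * m)%N, (0 < m)%N, ev (theta m) = ev [::]
    & forall i, (0 < i < m)%N -> ev (theta i) <> ev [::]].
Proof.
move=> Gk; have [j /andP[j0 _] j1] := exists_period ev_cat ev_sqr Gk.
have [m [m0 _ m1 mmin]] := least_period ev_cat j0 j1.
exists m; split=> //; apply: (has_order_unique Gk).
exact: (has_order_dihedral ev_cat ev_sqr).
Qed.

Lemma order_dvd_family n t :
  has_order G (2 * n) -> exists2 m, has_order (G_ t) m & (m %| 2 * n)%N.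
Proof.
move=> /order_period[m [-> m0 m1 _]].
by apply: (has_order_dvd (@ev_cat_ t) (@ev_sqr_ t)) => //; apply: specialize.
Qed.

(** The order of a quotient can drop only if a letter or a power of theta with
    exponent less than [m] becomes trivial: this concerns finitely many words, hence
    finitely many parameters. *)
Lemma finite_order_drop n : has_order G (2 * n) ->
  finite_set [set t | J t /\ ~ has_order (G_ t) (2 * n)].
Proof.
move=> Gn; have [m [nm m0 m1 mmin]] := order_period Gn; rewrite nm.
pose E u := [set t | J t /\ ev_ t u = ev_ t [::]].
apply: (@sub_finite_set _ _ ((E [:: true] `|` E [:: false]) `|`
  \bigcup_(i in [set i | (0 < i < m)%N]) E (theta i))); last first.
  rewrite !finite_setU; split; first by split; apply: finitely_many_exceptions.
  apply: bigcup_finite => [|i im]; last exact/finitely_many_exceptions/mmin.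
  by apply: sub_finite_set (finite_II m) => i /andP[].
move=> t [Jt not_order]; apply: contrapT => tE; apply: not_order.
apply: (has_order_dihedral (@ev_cat_ t) (@ev_sqr_ t)) => //.
- exact: specialize.
- by move=> b b1; apply: tE; left; case: b b1; [left | right].
- by move=> i im i1; apply: tE; right; exists i.
Qed.

Lemma order_iff_family n :
  has_order G (2 * n) <->
  infinite_set [set t | J t /\ has_order (G_ t) (2 * n)].
Proof.
split=> [Gn fin | inf].
  apply: J_infinite; apply: sub_finite_set (_ : finite_set (_ `|` _)).
    2: by rewrite finite_setU; split; [exact: fin | exact: (finite_order_drop Gn)].
  by move=> t Jt; have [|] := pselect (has_order (G_ t) (2 * n)); [left | right].
(* The factorial is an exponent that kills theta in every group of order [2 * n]. *)
have per : ev (theta (2 * n)`!) = ev [::].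
  apply: contrapT => /finitely_many_exceptions fin; apply: inf.
  apply: sub_finite_set fin => t.
  move=> [Jt /(exists_period (@ev_cat_ t) (@ev_sqr_ t))[j /andP[j0 jn] j1]].
  by split=> //; apply: (theta_dvd (@ev_cat_ t) j1); apply: dvdn_fact; rewrite j0.
have [m [m0 _ m1 mmin]] := least_period ev_cat (fact_gt0 _) per.
have Gm : has_order G (2 * m) by apply: (has_order_dihedral ev_cat ev_sqr).
have [t [Jt tn] tm] : exists2 t, J t /\ has_order (G_ t) (2 * n)
    & has_order (G_ t) (2 * m).
  apply: contrapT => none; apply: inf.
  apply: sub_finite_set (finite_order_drop Gm) => t [Jt tn]; split=> // tm.
  by apply: none; exists t.
by rewrite (has_order_unique tn tm).
Qed.

End DihedralFamily.

(** * Rational maps of the plane and their values at points *)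

Section RationalMaps.
Variable R : realType.
Local Notation C := R[i].
Local Notation K := (ratfun R).
Implicit Types (p q : {poly {poly C}}) (f g : K) (psi phi : K * K) (a b : C * C).

Local Notation ofpoly := (@ofpoly R).
Local Notation cst := (@Defs.cst R).

HB.instance Definition _ := GRing.RMorphism.copy ofpoly
  (@FracField.tofrac {poly {poly C}}).
HB.instance Definition _ := GRing.RMorphism.copy cst
  (ofpoly \o polyC \o polyC).

(** [polysubst] with its arguments swapped, so that it can be a ring morphism. *)
Definition polysubst_at psi p := polysubst p psi.
HB.instance Definition _ psi := GRing.RMorphism.copy (polysubst_at psi)
  (horner_eval psi.2 \o horner_eval psi.1%:P \o map_poly (map_poly cst)).

Lemma horner2D p q (x y : C) : (p + q).[x, y] = p.[x, y] + q.[x, y].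
Proof. by rewrite !hornerD. Qed.

Lemma horner2M p q (x y : C) : (p * q).[x, y] = p.[x, y] * q.[x, y].
Proof. by rewrite !hornerM. Qed.

Lemma ofpoly_eq0 p : (ofpoly p == 0) = (p == 0).
Proof. exact: tofrac_eq0. Qed.

Lemma repr_fraction f : f = ofpoly \n_(repr f) / ofpoly \d_(repr f).
Proof.
have d0 : ofpoly \d_(repr f) != 0 by rewrite ofpoly_eq0 denom_ratioP.
apply: (mulIf d0); rewrite mulfVK // -{1}[f]reprK /Defs.ofpoly; unlock FracField.tofrac.
rewrite -[LHS]FracField.pi_mul; apply/eqmodP.
by rewrite /= FracField.equivfE !numden_Ratio ?mulf_neq0 ?oner_neq0 ?denom_ratioP //
  !mulr1 mulrC.
Qed.

Lemma ofpoly_div_eq p q p' q' : q != 0 -> q' != 0 ->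
  ofpoly p / ofpoly q = ofpoly p' / ofpoly q' -> p * q' = p' * q.
Proof.
move=> q0 q0' /eqP; rewrite eqr_div ?ofpoly_eq0 //.
by rewrite -!rmorphM /= tofrac_eq => /eqP.
Qed.

Lemma horner2_neq0 p (x y : C) : p.[x, y] != 0 -> p != 0.
Proof. by apply: contraNneq => ->; rewrite !horner0. Qed.

Lemma has_value_unique f a c c' : has_value f a c -> has_value f a c' -> c = c'.
Proof.
move=> [p [q [q0 -> ->]]] [p' [q' [q0' + ->]]].
move=> /(ofpoly_div_eq (horner2_neq0 q0) (horner2_neq0 q0')).
move=> /(congr1 (fun p => p.[a.1, a.2])).
by rewrite !horner2M => e; apply/eqP; rewrite eqr_div // e.
Qed.

Lemma has_value_poly p a : has_value (ofpoly p) a p.[a.1, a.2].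
Proof.
by exists p, 1; rewrite rmorph1 divr1 !hornerE divr1 oner_neq0.
Qed.

Lemma has_value_cst (c : C) a : has_value (cst c) a c.
Proof. by have := has_value_poly c%:P%:P a; rewrite !hornerC. Qed.

Lemma has_value_varx a : has_value (varx R) a a.1.
Proof. by have := has_value_poly 'X a; rewrite !(hornerC, hornerX). Qed.

Lemma has_value_vary a : has_value (vary R) a a.2.
Proof. by have := has_value_poly 'Y a; rewrite !(hornerC, hornerX). Qed.

Lemma has_valueD f g a c d :
  has_value f a c -> has_value g a d -> has_value (f + g) a (c + d).
Proof.
move=> [p [q [q0 -> ->]]] [p' [q' [q0' -> ->]]].
exists (p * q' + p' * q), (q * q'); rewrite horner2M mulf_neq0 // horner2D !horner2M.
by rewrite !addf_div ?ofpoly_eq0 ?(horner2_neq0 q0) ?(horner2_neq0 q0') //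
  rmorphD !rmorphM.
Qed.

Lemma has_valueM f g a c d :
  has_value f a c -> has_value g a d -> has_value (f * g) a (c * d).
Proof.
move=> [p [q [q0 -> ->]]] [p' [q' [q0' -> ->]]].
exists (p * p'), (q * q'); rewrite horner2M mulf_neq0 // !horner2M.
by rewrite !mulf_div !rmorphM.
Qed.

Lemma has_value_neq0 f a c : c != 0 -> has_value f a c -> f != 0.
Proof.
move=> c0 fc; apply: contraNneq c0 => f0; apply/eqP/(has_value_unique fc).
by rewrite f0; have := has_value_cst 0 a; rewrite rmorph0.
Qed.

Lemma has_valueV f a c : c != 0 -> has_value f a c -> has_value f^-1 a c^-1.
Proof.
move=> c0 [p [q [q0 -> cE]]]; exists q, p; rewrite cE !invf_div; split=> //.
by apply: contraNneq c0 => p0; rewrite cE p0 mul0r.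
Qed.

Lemma polysubstX psi : polysubst_at psi 'X = psi.1.
Proof. by rewrite /polysubst_at /polysubst map_polyX hornerX hornerC. Qed.

Lemma polysubstY psi : polysubst_at psi 'Y = psi.2.
Proof. by rewrite /polysubst_at /polysubst map_polyC hornerC /= map_polyX hornerX. Qed.

Lemma polysubstC psi c : polysubst_at psi c%:P%:P = cst c.
Proof. by rewrite /polysubst_at /polysubst map_polyC hornerC /= map_polyC hornerC. Qed.

(** The universal property of the polynomial ring, uniqueness part. *)
Lemma rmorph_poly2_eq (S : nzRingType) (h k : {rmorphism {poly {poly C}} -> S}) :
  h 'X = k 'X -> h 'Y = k 'Y -> (forall c, h c%:P%:P = k c%:P%:P) -> h =1 k.
Proof.
move=> hX hY hC; elim/poly_ind => [|p c IH]; first by rewrite !rmorph0.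
rewrite rmorphD [RHS]rmorphD rmorphM [in RHS]rmorphM IH hX; congr (_ + _).
elim/poly_ind: c => [|c d IHc]; first by rewrite !rmorph0.
by rewrite polyCD polyCM rmorphD [RHS]rmorphD rmorphM [in RHS]rmorphM IHc hY hC.
Qed.

Lemma has_value_polysubst p psi a b :
  maps_to psi a b -> has_value (polysubst p psi) a p.[b.1, b.2].
Proof.
move=> [h1 h2]; rewrite -[polysubst p psi]/(polysubst_at psi p).
elim/poly_ind: p => [|p c IH].
  by rewrite rmorph0 !horner0; have := has_value_cst 0 a; rewrite rmorph0.
rewrite rmorphD rmorphM /= polysubstX horner2D horner2M hornerX !hornerC.
apply: has_valueD; first exact: has_valueM.
elim/poly_ind: c => [|c d IHc].
  by rewrite rmorph0 horner0; have := has_value_cst 0 a; rewrite rmorph0.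
rewrite polyCD polyCM rmorphD rmorphM /= polysubstY polysubstC !hornerE.
by apply: has_valueD; [apply: has_valueM | exact: has_value_cst].
Qed.

(** Exactly then the substitution of [psi] into fractions never creates a zero
    denominator. *)
Definition dominant psi := forall p, p != 0 -> polysubst p psi != 0.

Section SubstMorphism.
Variables (psi : K * K) (psi_dominant : dominant psi).

(** The proof of dominance is made an argument, since the morphism structure on the
    substitution depends on it. *)
Definition substm f := let _ := psi_dominant in subst f psi.

Lemma substm_div p q : q != 0 ->
  substm (ofpoly p / ofpoly q) = polysubst_at psi p / polysubst_at psi q.
Proof.
move=> q0; rewrite /substm /subst; set f := ofpoly p / ofpoly q.
have d0 : \d_(repr f) != 0 := denom_ratioP _.
have := ofpoly_div_eq q0 d0 (repr_fraction f).
move=> /(congr1 (polysubst_at psi)); rewrite !rmorphM => e.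
by apply/eqP; rewrite eqr_div; [exact/eqP/esym | exact: psi_dominant..].
Qed.

Lemma substm_poly p : substm (ofpoly p) = polysubst_at psi p.
Proof.
by rewrite -[ofpoly p]divr1 -(rmorph1 ofpoly) substm_div ?oner_neq0 // rmorph1 divr1.
Qed.

Fact substm_zmod_morphism : zmod_morphism substm.
Proof.
move=> f g; rewrite [f]repr_fraction [g]repr_fraction.
have f0 : \d_(repr f) != 0 := denom_ratioP _.
have g0 : \d_(repr g) != 0 := denom_ratioP _.
move: \n_(repr f) \n_(repr g) \d_(repr f) \d_(repr g) f0 g0 => p p' q q' q0 q0'.
rewrite !substm_div // -!mulNr -!rmorphN.
rewrite !addf_div ?ofpoly_eq0 ?q0 //; [|exact: psi_dominant..].
by rewrite -!rmorphM -!rmorphD substm_div ?mulf_neq0.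
Qed.

Fact substm_monoid_morphism : monoid_morphism substm.
Proof.
split=> [|f g]; first by have := substm_poly 1; rewrite !rmorph1.
rewrite [f]repr_fraction [g]repr_fraction.
have f0 : \d_(repr f) != 0 := denom_ratioP _.
have g0 : \d_(repr g) != 0 := denom_ratioP _.
move: \n_(repr f) \n_(repr g) \d_(repr f) \d_(repr g) f0 g0 => p p' q q' q0 q0'.
by rewrite !substm_div // !mulf_div -!rmorphM substm_div ?mulf_neq0.
Qed.

HB.instance Definition _ :=
  GRing.isZmodMorphism.Build K K substm substm_zmod_morphism.
HB.instance Definition _ :=
  GRing.isMonoidMorphism.Build K K substm substm_monoid_morphism.

Lemma subst_cst c : subst (cst c) psi = cst c.
Proof. by rewrite -[LHS]/(substm _) substm_poly polysubstC. Qed.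

Lemma subst_varx : subst (varx R) psi = psi.1.
Proof. by rewrite -[LHS]/(substm _) substm_poly polysubstX. Qed.

Lemma subst_vary : subst (vary R) psi = psi.2.
Proof. by rewrite -[LHS]/(substm _) substm_poly polysubstY. Qed.

Lemma ratcomp1l : ratcomp (ratid R) psi = psi.
Proof. by rewrite /ratcomp subst_varx subst_vary; case: psi. Qed.

Lemma polysubst_ratcomp p phi :
  polysubst p (ratcomp phi psi) = subst (polysubst p phi) psi.
Proof.
apply: (rmorph_poly2_eq (h := polysubst_at (ratcomp phi psi))
  (k := substm \o polysubst_at phi)) => [||c] /=.
- by rewrite !polysubstX.
- by rewrite !polysubstY.
- by rewrite !polysubstC /substm subst_cst.
Qed.

Lemma subst_ratcomp f phi : subst f (ratcomp phi psi) = subst (subst f phi) psi.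
Proof. by rewrite /subst !polysubst_ratcomp -[RHS]/(substm _) fmorph_div. Qed.

(** Dominance of the innermost map is what associativity takes. *)
Lemma ratcompA chi phi : ratcomp chi (ratcomp phi psi) = ratcomp (ratcomp chi phi) psi.
Proof. by rewrite {1}/ratcomp !subst_ratcomp. Qed.

Lemma dominant_ratcomp phi : dominant phi -> dominant (ratcomp phi psi).
Proof.
move=> phi_dom p /phi_dom p0.
by rewrite polysubst_ratcomp -[X in X != 0]/(substm _) fmorph_eq0.
Qed.

Lemma has_value_subst f a b c :
  maps_to psi a b -> has_value f b c -> has_value (subst f psi) a c.
Proof.
move=> ab [p [q [q0 -> ->]]].
rewrite -[subst _ _]/(substm _) substm_div ?(horner2_neq0 q0) //.
apply: has_valueM; first exact: has_value_polysubst.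
by apply: has_valueV => //; exact: has_value_polysubst.
Qed.

Lemma maps_to_ratcomp phi a b c :
  maps_to psi a b -> maps_to phi b c -> maps_to (ratcomp phi psi) a c.
Proof. by move=> ab [h1 h2]; split; apply: has_value_subst ab _. Qed.

End SubstMorphism.

Lemma polysubst_ratid p : polysubst p (ratid R) = ofpoly p.
Proof.
apply: (rmorph_poly2_eq (h := polysubst_at (ratid R)) (k := ofpoly)) => [||c].
- exact: polysubstX.
- exact: polysubstY.
- exact: polysubstC.
Qed.

Lemma dominant_ratid : dominant (ratid R).
Proof. by move=> p p0; rewrite polysubst_ratid ofpoly_eq0. Qed.

Lemma ratcomp1r phi : ratcomp phi (ratid R) = phi.
Proof.
case: phi => f g; rewrite /ratcomp /subst !polysubst_ratid.
by congr pair; apply/esym/repr_fraction.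
Qed.

Lemma maps_to_ratid a : maps_to (ratid R) a a.
Proof. by split; [exact: has_value_varx | exact: has_value_vary]. Qed.

Lemma maps_to_unique phi a b c : maps_to phi a b -> maps_to phi a c -> b = c.
Proof.
case: b c => [b1 b2] [c1 c2] [/= h1 h2] [/= h3 h4].
by rewrite (has_value_unique h1 h3) (has_value_unique h2 h4).
Qed.

(** A relation between the components of [psi] would hold at all points of the image
    of [psi], which is dense. *)
Lemma dominant_of_values psi :
  (forall p, p != 0 -> exists a b, maps_to psi a b /\ p.[b.1, b.2] != 0) ->
  dominant psi.
Proof.
move=> dense p /dense[a [b [ab pb]]].
exact: has_value_neq0 pb (has_value_polysubst p ab).
Qed.

(** Where both values exist and agree, the numerator of the difference vanishes. *)
Lemma common_values_curve f g : f <> g ->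
  exists2 F, F != 0 &
    forall a c, has_value f a c -> has_value g a c -> F.[a.1, a.2] = 0.
Proof.
move=> /eqP; rewrite -subr_eq0 => fg0.
have fgE := repr_fraction (f - g); have d0 : \d_(repr (f - g)) != 0 := denom_ratioP _.
exists \n_(repr (f - g)).
  by apply: contraNneq fg0 => n0; rewrite fgE n0 rmorph0 mul0r.
move=> a c fc gc.
have [p [q [q0 pqE]]] : has_value (f - g) a 0.
  rewrite -(subrr c); apply: has_valueD => //; rewrite -mulN1r -[- c]mulN1r.
  by apply: has_valueM => //; rewrite -(rmorphN1 cst); exact: has_value_cst.
move/esym/eqP; rewrite mulf_eq0 invr_eq0 (negbTE q0) orbF => /eqP p0.
have := ofpoly_div_eq (horner2_neq0 q0) d0 (etrans (esym pqE) fgE).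
move=> /(congr1 (fun r => r.[a.1, a.2])); rewrite !horner2M p0 mul0r => /esym/eqP.
by rewrite mulf_eq0 (negbTE q0) orbF => /eqP.
Qed.

(** Off a curve, a rational map other than the identity moves every point. Read
    contrapositively, this also proves identities of rational maps pointwise. *)
Lemma fixed_points_curve phi : phi <> ratid R ->
  exists2 F, F != 0 & forall a, maps_to phi a a -> F.[a.1, a.2] = 0.
Proof.
move=> phi1; have [e|ne] := pselect (phi.1 = varx R); last first.
  have [F F0 Fv] := common_values_curve ne; exists F => // a [h _].
  exact: Fv h (has_value_varx _).
have [e'|ne] := pselect (phi.2 = vary R); last first.
  have [F F0 Fv] := common_values_curve ne; exists F => // a [_ h].
  exact: Fv h (has_value_vary _).
by case: phi1; rewrite /ratid -e -e'; case: phi {e e'}.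
Qed.

End RationalMaps.

(** * The kernel curve in coordinates *)

Section Coordinates.
Variables (R : realType).
Local Notation C := R[i].
Local Notation weights := ('I_3 -> 'I_3 -> R).
Implicit Types (w : weights) (x y t : C).

(** Exchanging the coordinates turns one involution into the other; all that follows
    in this section is about the horizontal one. *)
Definition transpose w : weights := fun i j => w j i.

Definition coefpoly w (i : 'I_3) : {poly C} := \sum_(j < 3) (w i j)%:C *: 'X^j.

Local Notation A w := (coefpoly w ord_max).
Local Notation B w := (coefpoly w (inord 1)).
Local Notation C0 w := (coefpoly w ord0).

(** The kernel as a quadratic polynomial in [x]. *)
Definition kernel_at w t x y : C :=
  (A w).[y] * x ^+ 2 + ((B w).[y] - t^-1 * y) * x + (C0 w).[y].

Lemma coefpolyE w i y : (coefpoly w i).[y] = \sum_(j < 3) (w i j)%:C * y ^+ j.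
Proof. by rewrite /coefpoly horner_sum; under eq_bigr do rewrite hornerZ hornerXn. Qed.

Lemma ord3_sum (F : 'I_3 -> C) :
  \sum_(i < 3) F i = F ord0 + F (inord 1) + F ord_max.
Proof.
rewrite !big_ord_recl big_ord0 addr0 -addrA.
by congr (_ + (F _ + F _)); apply: val_inj; rewrite //= inordK.
Qed.

Lemma kernel_atE w t x y : kernel_at w t x y =
  \sum_(i < 3) \sum_(j < 3) (w i j)%:C * x ^+ i * y ^+ j - t^-1 * x * y.
Proof.
have -> : \sum_(i < 3) \sum_(j < 3) (w i j)%:C * x ^+ i * y ^+ j =
    \sum_(i < 3) (coefpoly w i).[y] * x ^+ i.
  apply: eq_bigr => i _; rewrite coefpolyE mulr_suml.
  by apply: eq_bigr => j _; rewrite mulrAC.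
by rewrite ord3_sum /kernel_at /= inordK // expr0 expr1; ring.
Qed.

Lemma kernel_at_transpose w t x y :
  kernel_at (transpose w) t y x = kernel_at w t x y.
Proof.
rewrite !kernel_atE exchange_big /=; congr (_ - _); last by rewrite mulrAC.
by apply: eq_bigr => i _; apply: eq_bigr => j _; rewrite mulrAC.
Qed.

(** The other root of the quadratic polynomial, the product of the roots being
    [C0 / A]. *)
Definition flip w x y : C := (C0 w).[y] / (x * (A w).[y]).

(** Its zeros are the heights at which [flip] may degenerate; the height 0 is included
    because the other involution degenerates there. *)
Definition degenerate_poly w : {poly C} := 'X * A w * C0 w.

Definition flippable w x y := x != 0 /\ (degenerate_poly w).[y] != 0.

Lemma flippableP w x y : flippable w x y ->
  [/\ x != 0, y != 0, (A w).[y] != 0 & (C0 w).[y] != 0].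
Proof.
by case=> x0; rewrite !hornerE !mulf_eq0 !negb_or => /andP[/andP[]].
Qed.

Lemma flip_neq0 w x y : flippable w x y -> flip w x y != 0.
Proof. by move=> /flippableP[x0 y0 a0 c0]; rewrite !mulf_neq0 ?invr_eq0 ?mulf_neq0. Qed.

Lemma flippable_flip w x y : flippable w x y -> flippable w (flip w x y) y.
Proof. by move=> n; split; [exact: flip_neq0 | case: n]. Qed.

Lemma flipK w x y : flippable w x y -> flip w (flip w x y) y = x.
Proof. by move=> /flippableP[x0 y0 a0 c0]; rewrite /flip; field; rewrite x0 a0 c0. Qed.

Lemma kernel_at_flip w t x y : flippable w x y ->
  kernel_at w t x y = 0 -> kernel_at w t (flip w x y) y = 0.
Proof.
move=> /flippableP[x0 y0 a0 c0] k0.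
suff -> : kernel_at w t (flip w x y) y =
    kernel_at w t x y * ((C0 w).[y] / (A w).[y] / x ^+ 2) by rewrite k0 mul0r.
by rewrite /kernel_at /flip; move: t^-1 => s; field; rewrite x0 a0.
Qed.

Definition kernel_poly w t y : {poly C} :=
  (A w).[y] *: 'X^2 + ((B w).[y] - t^-1 * y) *: 'X + (C0 w).[y]%:P.

Lemma root_kernel_poly w t x y : root (kernel_poly w t y) x = (kernel_at w t x y == 0).
Proof.
by rewrite /root /kernel_poly !(hornerD, hornerZ, hornerX, hornerXn, hornerC).
Qed.

Lemma coef_kernel_poly w t y : [/\ (kernel_poly w t y)`_0 = (C0 w).[y],
  (kernel_poly w t y)`_1 = (B w).[y] - t^-1 * y & (kernel_poly w t y)`_2 = (A w).[y]].
Proof.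
by rewrite /kernel_poly !coefE /= !mulr0 !mulr1 !addr0 !add0r; split.
Qed.

Definition line_parameters w : set C :=
  [set t | t != 0 /\ exists2 y, y != 0 & kernel_poly w t y = 0].

(** Such a line is at a height [y] where [A], [C0] and [B - y / t] vanish: the
    height is a root of [C0], and it determines [t]. *)
Lemma finite_line_parameters w : C0 w != 0 -> finite_set (line_parameters w).
Proof.
move=> c0.
apply: (@sub_finite_set _ _ ((fun y => y / (B w).[y]) @` [set y | root (C0 w) y])).
  move=> t [t0 [y y0 k0]].
  have [] := coef_kernel_poly w t y; rewrite k0 !coef0 => ek0 H _.
  exists y; first by rewrite /= /root -ek0.
  by move: H => /esym/eqP; rewrite subr_eq0 => /eqP ->; field; rewrite y0 t0.
by apply: finite_image; exact: finite_roots.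
Qed.

(** The line [y = 0] is never contained in the curve, as the kernel restricts to it as
    the bottom row of weights. *)
Lemma kernel_poly_neq0 w t y : C0 (transpose w) != 0 -> t != 0 ->
  ~ line_parameters w t -> kernel_poly w t y != 0.
Proof.
move=> c0 t0 noline; apply/eqP => k0.
have [] := coef_kernel_poly w t y; rewrite k0 !coef0 => ek0 ek1 ek2.
have [y0|y0] := eqVneq y 0; last first.
  by apply: noline; split=> //; exists y.
have w0 i : (w i ord0)%:C = 0 :> C.
  have -> : (w i ord0)%:C = (coefpoly w i).[y].
    by rewrite coefpolyE y0 !big_ord_recl big_ord0 /= !expr0n /= !mulr0 !addr0 mulr1.
  have ty0 : t^-1 * y = 0 by rewrite y0 mulr0.
  have b0 : 0 = (B w).[y] by rewrite [LHS]ek1 ty0 subr0.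
  have : i \in [:: ord0; inord 1; ord_max].
    by rewrite !inE -!val_eqE /= inordK //; case: i => -[|[|[]]].
  by rewrite !inE => /or3P[] /eqP ->.
by case/negP: c0; rewrite /coefpoly big1 // => j _; rewrite /transpose w0 scale0r.
Qed.

Lemma finite_kernel_fibers w t (H : {poly C}) :
  C0 (transpose w) != 0 -> t != 0 -> ~ line_parameters w t -> H != 0 ->
  finite_set [set a : C * C | root H a.2 /\ kernel_at w t a.1 a.2 = 0].
Proof.
move=> c0 t0 noline H0.
apply: (@sub_finite_set _ _ (\bigcup_(y in [set y | root H y])
  ((fun x => (x, y)) @` [set x | root (kernel_poly w t y) x]))).
  move=> [x y] /= [Hy kxy]; exists y => //; exists x => //=.
  by rewrite root_kernel_poly kxy.
apply: bigcup_finite; first exact: finite_roots.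
by move=> y _; apply: finite_image; apply/finite_roots/kernel_poly_neq0.
Qed.

Lemma kernel_at_root w t y : (A w).[y] != 0 -> exists x, kernel_at w t x y = 0.
Proof.
move=> a0; have /closed_rootP[x] : size (kernel_poly w t y) != 1.
  have s3 : (2 < size (kernel_poly w t y))%N.
    rewrite ltnNge; apply: contra a0 => /leq_sizeP/(_ 2 (leqnn _)).
    by have [_ _ ->] := coef_kernel_poly w t y => ->.
  by case: (size _) s3 => [|[]].
by rewrite root_kernel_poly => /eqP; exists x.
Qed.

(** Off the axes the inventory has the value [t^-1] on the curve. *)
Lemma kernel_at_parameter w t t' x y : x != 0 -> y != 0 ->
  kernel_at w t x y = 0 -> kernel_at w t' x y = 0 -> t = t'.
Proof.
move=> x0 y0; rewrite !kernel_atE => /eqP; rewrite subr_eq0 => /eqP -> /eqP.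
rewrite subr_eq0 -!mulrA => /eqP h; apply: invr_inj.
exact: (mulIf (mulf_neq0 x0 y0)).
Qed.

End Coordinates.

(** * The two involutions on points and on the curve *)

Lemma div_cancel (F : fieldType) (x a c d : F) : d != 0 ->
  c / d / (x * (a / d)) = c / (x * a).
Proof. by move=> d0; rewrite mulrA invf_div mulrA divfK. Qed.

Section Involutions.
Variables (R : realType) (W : walk R).
Local Notation C := R[i].
Local Notation K := (ratfun R).
Local Notation w := (weight W).
Local Notation wT := (transpose w).
Implicit Types (a : C * C) (t : C) (u : seq bool).

Definition phi (b : bool) : K * K := if b then phi1 W else phi2 W.

Definition move_pt (b : bool) a : C * C :=
  if b then (flip w a.1 a.2, a.2) else (a.1, flip wT a.2 a.1).

Definition movable (b : bool) a :=
  if b then flippable w a.1 a.2 else flippable wT a.2 a.1.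

Lemma coefxE (v : 'I_3 -> 'I_3 -> R) i :
  coefx v i = ofpoly (coefpoly v i)%:P / vary R.
Proof.
have y0 : vary R != 0 by rewrite ofpoly_eq0 polyC_eq0 polyX_eq0.
rewrite /coefx /coefpoly rmorph_sum rmorph_sum mulr_suml; apply: eq_bigr => j _ /=.
rewrite /step expfzDr // exprN1 -exprnP mulrA; congr (_ / _).
by rewrite -mul_polyC polyCM rmorphM polyC_exp rmorphXn.
Qed.

Lemma coefyE (v : 'I_3 -> 'I_3 -> R) j :
  coefy v j = ofpoly (swapXY (coefpoly (transpose v) j)%:P) / varx R.
Proof.
have x0 : varx R != 0 by rewrite ofpoly_eq0 polyX_eq0.
rewrite /coefy /coefpoly !rmorph_sum mulr_suml; apply: eq_bigr => i _ /=.
rewrite /step expfzDr // exprN1 -exprnP mulrA; congr (_ / _).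
have -> : swapXY ((transpose v j i)%:C *: 'X^i)%:P = (v i j)%:C%:P%:P * 'X ^+ i.
  rewrite -mul_polyC polyCM polyC_exp rmorphM rmorphXn /= swapXY_Y.
  by rewrite swapXY_polyC map_polyC.
by rewrite rmorphM rmorphXn.
Qed.

Lemma coefx_neq0 (v : 'I_3 -> 'I_3 -> R) i :
  coefx v i != 0 -> coefpoly v i != 0.
Proof. by apply: contraNneq => c0; rewrite coefxE c0 !rmorph0 mul0r. Qed.

Lemma coefy_neq0 (v : 'I_3 -> 'I_3 -> R) i :
  coefy v i != 0 -> coefpoly (transpose v) i != 0.
Proof. by apply: contraNneq => c0; rewrite coefyE c0 !rmorph0 mul0r. Qed.

Let A10 := coefx_neq0 (A1_neq0 W).
Let C10 := coefx_neq0 (C1_neq0 W).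
Let A20 := coefy_neq0 (A2_neq0 W).
Let C20 := coefy_neq0 (C2_neq0 W).

Lemma phi1E : (phi1 W).1 = ofpoly (coefpoly w ord0)%:P /
  ofpoly ('X * (coefpoly w ord_max)%:P).
Proof.
have d0 : vary R != 0 by rewrite ofpoly_eq0 polyC_eq0 polyX_eq0.
rewrite [ofpoly ('X * _)](rmorphM (@ofpoly R) 'X) -[X in _ / (X * _)]/(varx R).
rewrite /= /C1 /A1 !coefxE.
exact: div_cancel.
Qed.

Lemma phi2E : (phi2 W).2 = ofpoly (swapXY (coefpoly wT ord0)%:P) /
  ofpoly ('Y * swapXY (coefpoly wT ord_max)%:P).
Proof.
have d0 : varx R != 0 by rewrite ofpoly_eq0 polyX_eq0.
rewrite [ofpoly ('Y * _)](rmorphM (@ofpoly R) 'Y) -[X in _ / (X * _)]/(vary R).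
rewrite /= /C2 /A2 !coefyE.
exact: div_cancel.
Qed.

(** Cleared of denominators, [C1 / (x * A1) = x] becomes an equation between
    polynomials in [x] whose constant term is the nonzero [coefpoly w ord0]. *)
Lemma phi_neq_ratid b : phi b <> ratid R.
Proof.
case: b => [/(congr1 fst)|/(congr1 snd)].
  rewrite [LHS]phi1E [RHS]/=.
  rewrite -[varx R]divr1 -(rmorph1 (@ofpoly R)) /varx.
  move=> /ofpoly_div_eq; rewrite mulf_neq0 ?polyX_eq0 ?polyC_eq0 // oner_neq0.
  move=> /(_ isT isT); rewrite mulr1.
  move=> /(congr1 (fun p : {poly {poly C}} => p`_0)).
  by rewrite coefC /= coefXM => /eqP; rewrite (negbTE C10).
rewrite [LHS]phi2E [RHS]/=.
rewrite -[vary R]divr1 -(rmorph1 (@ofpoly R)) /vary.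
move=> /ofpoly_div_eq; rewrite mulf_neq0 ?swapXY_eq0 ?polyC_eq0 ?polyX_eq0 // oner_neq0.
move=> /(_ isT isT)/(congr1 (@swapXY C)); rewrite mulr1 !rmorphM /= !swapXYK swapXY_Y.
move=> /(congr1 (fun p : {poly {poly C}} => p`_0)).
by rewrite coefC /= coefXM => /eqP; rewrite (negbTE C20).
Qed.

Lemma maps_to_phi b a : movable b a -> maps_to (phi b) a (move_pt b a).
Proof.
case: b a => -[x y] /= /flippableP[/= x0 y0 a0 c0]; split; rewrite /=.
- rewrite -[_ / _]/((phi1 W).1) phi1E.
  exists (coefpoly w ord0)%:P, ('X * (coefpoly w ord_max)%:P).
  by rewrite !hornerE /= mulf_neq0.
- exact: (has_value_vary (x, y)).
- exact: (has_value_varx (x, y)).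
- rewrite -[_ / _]/((phi2 W).2) phi2E.
  exists (swapXY (coefpoly wT ord0)%:P), ('Y * swapXY (coefpoly wT ord_max)%:P).
  by rewrite horner2M !horner2_swapXY !hornerE /= mulf_neq0.
Qed.

Lemma movable_move b a : movable b a -> movable b (move_pt b a).
Proof. by case: b => /=; exact: flippable_flip. Qed.

Lemma move_ptK b a : movable b a -> move_pt b (move_pt b a) = a.
Proof. by case: b a => -[x y] /= /flipK ->. Qed.

Lemma degenerate_poly_neq0 b : degenerate_poly (if b then w else wT) != 0.
Proof. by case: b; rewrite !mulf_neq0 ?polyX_eq0. Qed.

Lemma exists_movable b (F : {poly {poly C}}) : F != 0 ->
  exists2 a, movable b a & F.[a.1, a.2] != 0.
Proof.
move=> F0; case: b.
  have : F * ('X * (degenerate_poly w)%:P) != 0.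
    by rewrite !mulf_neq0 ?polyX_eq0 ?polyC_eq0 // (degenerate_poly_neq0 true).
  move=> /exists_nonroot2[x [y]].
  rewrite !horner2M !mulf_eq0 !negb_or !(hornerX, hornerC).
  by move=> /andP[Fxy /andP[x0 ry]]; exists (x, y).
have : F * ('Y * swapXY (degenerate_poly wT)%:P) != 0.
  rewrite !mulf_neq0 ?swapXY_eq0 ?polyC_eq0 ?polyX_eq0 //.
  exact: (degenerate_poly_neq0 false).
move=> /exists_nonroot2[x [y]].
rewrite !horner2M !mulf_eq0 !negb_or horner2_swapXY !(hornerX, hornerC).
by move=> /andP[Fxy /andP[x0 ry]]; exists (x, y).
Qed.

(** [phi b] is onto a dense set of points, on which it is its own inverse. *)
Lemma phi_dominant b : dominant (phi b).
Proof.
apply: dominant_of_values => p p0; have [a na pa] := exists_movable b p0.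
exists (move_pt b a), a; split=> //.
by rewrite -{2}(move_ptK na); apply: maps_to_phi; exact: movable_move.
Qed.

(** The composite fixes a dense set of points. *)
Lemma phi_involution b : ratcomp (phi b) (phi b) = ratid R.
Proof.
apply: contrapT => /fixed_points_curve[F F0 Ffix].
have [a na /eqP] := exists_movable b F0; apply; apply: Ffix.
apply: (maps_to_ratcomp (phi_dominant b) (maps_to_phi na)).
by rewrite -{2}(move_ptK na); apply: maps_to_phi; exact: movable_move.
Qed.

Lemma kernel_horner t a : (kernel W t).[a.1, a.2] = kernel_at w t a.1 a.2.
Proof.
rewrite /kernel !hornerD !hornerN kernel_atE; congr (_ - _); last first.
  by rewrite !horner2M !(hornerX, hornerC).
rewrite !horner_sum; apply: eq_bigr => i _; rewrite !horner_sum; apply: eq_bigr => j _.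
by rewrite !horner2M !hornerXn -!polyC_exp !hornerC hornerXn.
Qed.

Lemma kernel_move b t a : movable b a ->
  kernel_at w t a.1 a.2 = 0 ->
  kernel_at w t (move_pt b a).1 (move_pt b a).2 = 0.
Proof.
case: b => /= na; first exact: kernel_at_flip.
rewrite -kernel_at_transpose -[X in _ -> X = _]kernel_at_transpose.
exact: kernel_at_flip.
Qed.

End Involutions.

(** * Words of the two groups *)

Section Words.
Variables (R : realType) (W : walk R).
Local Notation C := R[i].
Local Notation K := (ratfun R).
Local Notation w := (weight W).
Local Notation wT := (transpose w).
Local Notation phi := (phi W).
Implicit Types (t : C) (u v : seq bool).

Definition ratword u : K * K := foldr (fun b => @ratcomp R (phi b)) (ratid R) u.

Lemma dominant_ratword u : dominant (ratword u).
Proof.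
elim: u => [|b u IH]; first exact: dominant_ratid.
exact: dominant_ratcomp IH _ (phi_dominant W b).
Qed.

Lemma ratword_cat u v : ratword (u ++ v) = ratcomp (ratword u) (ratword v).
Proof.
elim: u => [|b u IH]; first by rewrite ratcomp1l //; exact: dominant_ratword.
by rewrite /= IH ratcompA //; exact: dominant_ratword.
Qed.

Lemma ratword_letter b : ratword [:: b] = phi b. Proof. exact: ratcomp1r. Qed.

Lemma ratword_sqr b : ratword [:: b; b] = ratword [::].
Proof. by rewrite /= ratcomp1r phi_involution. Qed.

Lemma walk_groupE : walk_group W = range ratword.
Proof.
rewrite -(generated_group_words ratword_cat ratword_sqr) /walk_group.
by rewrite !ratword_letter.
Qed.

Section Curve.
Variable t : C.
Local Notation S := (regular_locus W t).

Lemma restriction_exists b : exists f : S -> S, restricts W t (phi b) f.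
Proof.
suff /choice[f fP] : forall a : S, exists a' : S, maps_to (phi b) (\val a) (\val a').
  by exists f.
move=> a; have /set_mem[X Xstable Xa] := valP a.
have [a' Xa' aa'] : exists2 a', X a' & maps_to (phi b) (\val a) a'.
  by have [_ /(_ _ Xa)[h1 h2]] := Xstable; case: b.
by exists (SigSub (mem_set (ex_intro2 _ _ X Xstable Xa'))).
Qed.

Definition restriction b : S -> S := sval (cid (restriction_exists b)).

Lemma restrictionP b : restricts W t (phi b) (restriction b).
Proof. exact: (svalP (cid (restriction_exists b))). Qed.

Lemma restricts_unique psi f g : restricts W t psi f -> restricts W t psi g -> f = g.
Proof.
move=> fP gP; apply/funext => a; apply: val_inj; exact: maps_to_unique (fP a) (gP a).
Qed.

Definition curveword u : S -> S := foldr (fun b f => restriction b \o f) id u.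

Lemma restricts_curveword u : restricts W t (ratword u) (curveword u).
Proof.
elim: u => [a|b u IH a]; first exact: maps_to_ratid.
by apply: (maps_to_ratcomp (dominant_ratword u) (IH a)); exact: restrictionP.
Qed.

Lemma curveword_id u : ratword u = ratword [::] -> curveword u = curveword [::].
Proof.
move=> u1; apply: (restricts_unique (restricts_curveword u)).
by rewrite u1; exact: restricts_curveword.
Qed.

Lemma curveword_cat u v : curveword (u ++ v) = curveword u \o curveword v.
Proof. by elim: u => // b u IH; rewrite /= IH. Qed.

Lemma curve_groupE : curve_group W t = range curveword.
Proof.
rewrite -(generated_group_words curveword_cat (fun b => curveword_id (ratword_sqr b))).
rewrite /curve_group; congr generated_group; apply/seteqP; split=> f.
  move=> [fP|fP]; [left | right].
    exact: restricts_unique fP (restrictionP true).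
  exact: restricts_unique fP (restrictionP false).
by move=> [] ->; [left; exact: (restrictionP true) |
  right; exact: (restrictionP false)].
Qed.

End Curve.
Arguments curveword t u : clear implicits.

(** * The regular locus is large *)

(** Unlike in [ratword] and [curveword], the head of the word acts first: the orbit of a
    point is explored from the point on. *)
Fixpoint move_word u a : C * C :=
  if u is b :: u' then move_word u' (move_pt W b a) else a.

Lemma move_word_rcons u b a : move_word (rcons u b) a = move_pt W b (move_word u a).
Proof. by elim: u a => //= c u IH a; rewrite IH. Qed.

Definition movable_both a := forall b, movable W b a.

Definition curve t : set (C * C) := [set a | kernel_at w t a.1 a.2 = 0].

(** The points with this property form a stable set. *)
Lemma regular_of_movable_orbit t a :
  curve t a -> (forall u, movable_both (move_word u a)) -> regular_locus W t a.
Proof.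
move=> ta nice_a.
exists [set a | curve t a /\ forall u, movable_both (move_word u a)] => //.
split=> [c [tc _]|c [tc nice_c]]; first by rewrite /kernel_curve /= kernel_horner.
have step b : exists2 c', curve t c' /\ (forall u, movable_both (move_word u c'))
    & maps_to (phi b) c c'.
  have nc := nice_c [::] b.
  exists (move_pt W b c); last exact: maps_to_phi.
  by split=> [|u]; [exact: kernel_move | exact: (nice_c (b :: u))].
by split; [exact: (step true) | exact: (step false)].
Qed.

(** The orbit can be run backwards from its first point at which an involution
    degenerates, as each step before it was invertible. *)
Lemma irregular_reached t a u : curve t a -> ~ movable_both (move_word u a) ->
  exists v c, [/\ curve t c, ~ movable_both c & a = move_word v c].
Proof.
elim: u a => [|b u IH] a ta /= bad; first by exists [::], a.
have [nice_a|] := pselect (movable_both a); last by exists [::], a.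
have [v [c [tc badc ec]]] := IH _ (kernel_move (nice_a b) ta) bad.
exists (rcons v b), c; split=> //.
by rewrite move_word_rcons -ec move_ptK.
Qed.

(** The curve contains a horizontal or a vertical line other than the axes. *)
Definition exceptional_parameters : set C := line_parameters w `|` line_parameters wT.

Lemma finite_exceptional_parameters : finite_set exceptional_parameters.
Proof.
rewrite finite_setU; split; apply: finite_line_parameters.
  exact: coefx_neq0 (C1_neq0 W).
exact: coefy_neq0 (C2_neq0 W).
Qed.

(** Such a point lies at one of finitely many heights or abscissas, and the curve
    contains none of the corresponding lines. *)
Lemma finite_bad_points t : t != 0 -> ~ exceptional_parameters t ->
  finite_set [set a | curve t a /\ ~ movable_both a].
Proof.
move=> t0 tE.
pose V : set (C * C) :=
  [set a | root (degenerate_poly w) a.2 /\ kernel_at w t a.1 a.2 = 0].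
pose H := [set a : C * C | root (degenerate_poly wT) a.2 /\ kernel_at wT t a.1 a.2 = 0].
apply: (@sub_finite_set _ _ (V `|` (fun a => (a.2, a.1)) @` H)).
  move=> [x y] [txy bad]; apply: contrapT => /not_orP[Vn Hn]; apply: bad.
  have Vxy : ~~ root (degenerate_poly w) y by apply/negP => ry; apply: Vn.
  have Hxy : ~~ root (degenerate_poly wT) x.
    apply/negP => rx; apply: Hn; exists (y, x) => //; split=> //.
    by rewrite kernel_at_transpose.
  have nz (p : 'I_3 -> 'I_3 -> R) z : ~~ root (degenerate_poly p) z -> z != 0.
    by apply: contraNneq => ->; rewrite /root /degenerate_poly !hornerM hornerX !mul0r.
  by case; split=> //=; [exact: nz Hxy | exact: nz Vxy].
rewrite finite_setU; split; last apply: finite_image.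
  apply: finite_kernel_fibers => //; [exact: coefy_neq0 (C2_neq0 W)| |].
    by move=> h; apply: tE; left.
  exact: (degenerate_poly_neq0 W true).
apply: finite_kernel_fibers => //; [exact: coefx_neq0 (C1_neq0 W)| |].
  by move=> h; apply: tE; right.
exact: (degenerate_poly_neq0 W false).
Qed.

Lemma countable_irregular t : t != 0 -> ~ exceptional_parameters t ->
  countable (curve t `\` regular_locus W t).
Proof.
move=> t0 tE.
apply: (@sub_countable _ _ _ (\bigcup_(v in [set: seq bool])
  (move_word v @` [set a | curve t a /\ ~ movable_both a]))).
  apply: subset_card_le => a [ta irr].
  have [u bad] : exists u, ~ movable_both (move_word u a).
    by apply/existsNP => nice_a; apply: irr; exact: regular_of_movable_orbit.
  have [v [c [tc badc ->]]] := irregular_reached ta bad.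
  by exists v => //; exists c.
apply: bigcup_countable => [|v _]; first exact: countableP.
by apply/finite_set_countable/finite_image/finite_bad_points.
Qed.

(** Suppose that there are infinitely many such parameters. Choose a line [y = y0]
    that avoids the countable set of heights of irregular points of [size F] of the
    curves, where [F = 0] contains the fixed points of the word. The line meets
    these curves in distinct regular points; all of them are fixed, so the
    restriction of [F] to the line has too many roots. *)
Lemma finite_trivial_restrictions u : ratword u <> ratword [::] ->
  finite_set [set t | t != 0 /\ curveword t u = curveword t [::]].
Proof.
move=> /fixed_points_curve[F F0 Ffix]; apply: contrapT => inf.
have {inf} := infinite_setD inf finite_exceptional_parameters.
move=> /(@infinite_set_seq _ _ (size F))[B [uB sB Bgood]].
pose p := lead_coef F * degenerate_poly w.
have p0 : p != 0 by rewrite mulf_neq0 ?lead_coef_eq0 // (degenerate_poly_neq0 W true).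
pose heights : set C := [set y | root p y]
  `|` \bigcup_(t in [set` B]) (snd @` (curve t `\` regular_locus W t)).
have [y0 y0P] : exists y, ~ heights y.
  apply/uncountable_complex/countableU.
    exact/finite_set_countable/finite_roots.
  apply: bigcup_countable => [|t /Bgood[[t0 _] tE]];
    first exact/finite_set_countable/finite_seqP/ex_intro.
  exact/countable_image/countable_irregular.
have [/= ly ry] : ~~ root (lead_coef F) y0 /\ ~~ root (degenerate_poly w) y0.
  by apply/andP; rewrite -negb_or -rootM; apply/negP => py; apply: y0P; left.
have [y00 ay0 cy0] :
    [/\ y0 != 0, (coefpoly w ord_max).[y0] != 0 & (coefpoly w ord0).[y0] != 0].
  move: ry; rewrite /root !hornerM hornerX !mulf_eq0 !negb_or.
  by move=> /andP[/andP[]].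
have [x xP] := choice (fun t => kernel_at_root t ay0).
have x0 t : x t != 0.
  apply: contraNneq cy0 => xt0; have := xP t.
  by rewrite /kernel_at xt0 expr0n !mulr0 !add0r => ->.
have := max_poly_roots (rs := [seq x t | t <- B]) (lead_coef_eval ly).
have -> : all (root (map_poly (horner_eval y0) F)) [seq x t | t <- B].
  apply/allP => _ /mapP[t tB ->]; rewrite /root -horner2_eval.
  have [[t0 tid] _] := Bgood t tB.
  have reg : regular_locus W t (x t, y0).
    apply: contrapT => irr; apply: y0P; right; exists t => //.
    by exists (x t, y0) => //; split=> //; exact: xP.
  apply/eqP/(Ffix (x t, y0)).
  by have := restricts_curveword u (SigSub (mem_set reg)); rewrite tid.
rewrite map_inj_in_uniq //; last first.
  move=> t t' _ _ xtt'; apply: (kernel_at_parameter (x0 t) y00 (xP t)).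
  by rewrite xtt'; exact: xP.
move=> /(_ isT uB); rewrite size_map => /leq_trans/(_ (size_poly _ _)).
by rewrite ltnNge sB.
Qed.

End Words.
Arguments curveword {R} W t u.

Theorem theorem2p4 (R : realType) (W : walk R) (n : nat) (hn : (0 < n)%N) :
  (has_order (walk_group W) (2 * n)%N <->
   infinite_set [set t : R[i] | t != 0 /\ has_order (curve_group W t) (2 * n)%N])
  /\
  (has_order (walk_group W) (2 * n)%N ->
   forall t : R[i], t != 0 ->
     exists2 m : nat, has_order (curve_group W t) m & (m %| 2 * n)%N).
Proof.
have letters b : ratword W [:: b] <> ratword W [::].
  by rewrite ratword_letter; exact: phi_neq_ratid.
have nonzero_infinite : infinite_set [set t : R[i] | t != 0].
  move=> fin; have [z] : exists z : R[i], ~ ([set t | t != 0] `|` [set 0]) z.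
    by apply/uncountable_complex/finite_set_countable; rewrite finite_setU.
  by apply; have [->|z0] := eqVneq z 0; [right | left].
have sqr t b : curveword W t [:: b; b] = curveword W t [::].
  exact/curveword_id/ratword_sqr.
rewrite walk_groupE; split; last first.
  move=> Gn t _; rewrite curve_groupE.
  apply: (order_dvd_family (ratword_cat W) (ratword_sqr W) letters
    (T_ := fun t => regular_locus W t -> regular_locus W t) (op_ := fun t f g => f \o g)
    (@curveword_cat _ W) sqr (@curveword_id _ W) _ Gn).
have -> : [set t : R[i] | t != 0 /\ has_order (curve_group W t) (2 * n)] =
    [set t : R[i] | [set t | t != 0] t /\ has_order (range (curveword W t)) (2 * n)].
  by apply: eq_set => t; rewrite curve_groupE.
apply: (order_iff_family (ratword_cat W) (ratword_sqr W) letters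
  (T_ := fun t => regular_locus W t -> regular_locus W t) (op_ := fun t f g => f \o g)
  nonzero_infinite (@curveword_cat _ W) sqr (@curveword_id _ W)).
exact: finite_trivial_restrictions.
Qed.
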